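(* Consider iteration $j$ of the enhanced column-and-constraint-generation (ECCG) algorithm described in the context, with trial solution $\mathbf{x}^{(j)}\in\mathcal{X}$. For each $\omega\in\Omega$, let $\underline{H}_{DR}(\mathbf{x}^{(j)},\omega)$ and $\overline{c}^*_\omega$ be the values computed at the last inner iteration of the inner loop for $\omega$. Let $\overline{H}_{DR}(\mathbf{x}^{(j)},\omega)=\underline{H}_{DR}(\mathbf{x}^{(j)},\omega)+\overline{c}^*_\omega$ and $$UB^{(j)}=\mathbf{c}_{inv}^{\top}\mathbf{x}^{(j)}+\sum_{\omega\in\Omega}\rho_\omega\,\overline{H}_{DR}(\mathbf{x}^{(j)},\omega).$$ Then: 1. $UB^{(j)}$ is an upper bound for the distributionally robust problem, i.e. $z^*_{DR}\le UB^{(j)}$, where $z^*_{DR}=\min_{\mathbf{x}\in\mathcal{X}}\{\mathbf{c}_{inv}^\top\mathbf{x}+\sum_{\omega\in\Omega}\rho_\omega H_{DR}(\mathbf{x},\omega)\}$. 2. $UB^{(j)}$ is $\epsilon$-tight for $\mathbf{x}^{(j)}$ when $L=+\infty$ (the inner loop for each $\omega$ is stopped only by the criterion $\overline{c}^*_\omega\le\epsilon$); that is, $$UB^{(j)}\le \mathbf{c}_{inv}^{\top}\mathbf{x}^{(j)}+\sum_{\omega\in\Omega}\rho_\omega H_{DR}(\mathbf{x}^{(j)},\omega)+|\Omega|\,\epsilon .$$ In particular, for $\epsilon=0$, $UB^{(j)}=\mathbf{c}_{inv}^{\top}\mathbf{x}^{(j)}+\sum_{\omega\in\Omega}\rho_\omega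 H_{DR}(\mathbf{x}^{(j)},\omega)$.
   Context: **Uncertainty.** $(\mathcal{S},\mathbb{S})$ is a measurable space and $\tilde{\boldsymbol\xi}:\mathcal{S}\to\Xi\subset\mathbb{R}^d$ is measurable. $\Omega$ is a finite set of indices (long-term scenarios) and $\{\mathcal{S}_\omega\}_{\omega\in\Omega}$ is a partition of $\mathcal{S}$, with restricted measurable spaces $(\mathcal{S}_\omega,\mathbb{S}_\omega)$. The conditional supports $\Xi_\omega=\tilde{\boldsymbol\xi}(\mathcal{S}_\omega)$ are bounded polyhedra with (finite) sets of extreme points $\mathcal{E}_\omega$; they need not be disjoint. Vectors $\underline{\boldsymbol\mu}_\omega\le\overline{\boldsymbol\mu}_\omega$ in $\mathbb{R}^d$ are given (inequalities are componentwise), with $(\underline{\boldsymbol\mu}_\omega+\overline{\boldsymbol\mu}_\omega)/2\in\Xi_\omega$. Numbers $\rho_\omega\in[0,1]$ (probabilities or weights) are given. Let $\mathcal{P}_\omega$ be the set of all probability measures on $(\mathcal{S}_\omega,\mathbb{S}_\omega)$, write $\mathbb{E}_P[h(\tilde{\boldsymbol\xi})\mid\mathcal{S}_\omega]=\int_{\mathcal{S}_\omega}h(\tilde{\boldsymbol\xi})\,dP$, and define the conditional ambiguity set $$\mathcal{D}_\omega=\{P\in\mathcal{P}_\omega:\ \underline{\boldsymbol\mu}_\omega\le\mathbb{E}_P[\tilde{\boldsymbol\xi}\mid\mathcal{S}_\omega]\le\overline{\boldsymbol\mu}_\omega\}.$$ **Two-stage problem.** $\mathcal{X}$ is the set of feasible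 (binary) investment vectors and $\mathbf{c}_{inv}$ is the investment cost vector. The second-stage cost is $$g(\mathbf{x},\boldsymbol\xi,\omega)=\min_{\mathbf{y}\ge0}\{\mathbf{h}_\omega^\top\mathbf{y}:\ \mathbf{W}_\omega\mathbf{y}\ge\mathbf{b}_\omega+\mathbf{B}_\omega\boldsymbol\xi-\mathbf{T}_\omega\mathbf{x}\},$$ with given matrices and vectors such that this linear program is feasible with finite optimal value for all $\mathbf{x}\in\mathcal{X}$, $\omega\in\Omega$, $\boldsymbol\xi\in\Xi_\omega$. The distributionally robust recourse function is $H_{DR}(\mathbf{x},\omega)=\sup_{P\in\mathcal{D}_\omega}\mathbb{E}_P[g(\mathbf{x},\tilde{\boldsymbol\xi},\omega)\mid\mathcal{S}_\omega]$. **ECCG algorithm.** Parameters: inner tolerance $\epsilon\ge0$, maximum number of inner iterations $L\in\{1,2,\dots\}\cup\{+\infty\}$, number $M\le L$ of scenarios added to the master problem per main iteration, main tolerance $\varepsilon$. Initialization: $\mathcal{E}_\omega^{(0)}=\{\boldsymbol\xi_\omega^0\}$ with $\boldsymbol\xi^0_\omega=(\underline{\boldsymbol\mu}_\omega+\overline{\boldsymbol\mu}_\omega)/2$. Main iteration $j$, with current finite scenario sets $\mathcal{E}_\omega^{(j)}=\{\boldsymbol\xi^k_\omega\}_{k\in K^{(j)}_\omega}$ (containing $\boldsymbol\xi^0_\omega$, the other elements being extreme points of $\Xi_\omega$): (i) Master problem: $\mathbf{x}^{(j)}$ is the $\mathbf{x}$-part of an optimal solution of the minimization, over $\mathbf{x}\in\mathcal{X}$,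 $\mathbf{y}^k_\omega\ge0$, $\alpha_{0\omega}\in\mathbb{R}$, $\overline{\boldsymbol\alpha}_\omega,\underline{\boldsymbol\alpha}_\omega\ge0$, of $\mathbf{c}_{inv}^\top\mathbf{x}+\sum_\omega\rho_\omega[\alpha_{0\omega}+\overline{\boldsymbol\mu}_\omega^\top\overline{\boldsymbol\alpha}_\omega-\underline{\boldsymbol\mu}_\omega^\top\underline{\boldsymbol\alpha}_\omega]$ subject to $\alpha_{0\omega}+(\overline{\boldsymbol\alpha}_\omega-\underline{\boldsymbol\alpha}_\omega)^\top\boldsymbol\xi^k_\omega\ge\mathbf{h}_\omega^\top\mathbf{y}^k_\omega$ and $\mathbf{W}_\omega\mathbf{y}^k_\omega\ge\mathbf{b}_\omega+\mathbf{B}_\omega\boldsymbol\xi^k_\omega-\mathbf{T}_\omega\mathbf{x}$ for all $\omega\in\Omega$, $k\in K_\omega^{(j)}$. The optimal value is the lower bound $LB^{(j)}$. (ii) Inner loop (Dantzig–Wolfe procedure), separately for each $\omega$. Starting with $n=1$, solve the restricted recourse problem $$\underline{H}_{DR}(\mathbf{x}^{(j)},\omega)=\max_{p^k\ge0}\Big\{\sum_{k\in K^{(j)}_\omega}g(\mathbf{x}^{(j)},\boldsymbol\xi^k_\omega,\omega)p^k:\ \sum_k p^k=1,\ \underline{\boldsymbol\mu}_\omega\le\sum_k\boldsymbol\xi^k_\omega p^k\le\overline{\boldsymbol\mu}_\omega\Big\},$$ with optimal dual solution $\alpha^{(j)}_{0\omega}\in\mathbb{R}$, $\underline{\boldsymbol\alpha}^{(j)}_\omega\ge0$,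 $\overline{\boldsymbol\alpha}^{(j)}_\omega\ge0$, i.e. a minimizer of $\alpha_0+\overline{\boldsymbol\mu}_\omega^\top\overline{\boldsymbol\alpha}-\underline{\boldsymbol\mu}_\omega^\top\underline{\boldsymbol\alpha}$ subject to $\alpha_0+(\overline{\boldsymbol\alpha}-\underline{\boldsymbol\alpha})^\top\boldsymbol\xi^k_\omega\ge g(\mathbf{x}^{(j)},\boldsymbol\xi^k_\omega,\omega)$ for all $k\in K_\omega^{(j)}$. Then solve the oracle $$\overline{c}^*_\omega=\max_{\boldsymbol\xi\in\Xi_\omega}\{g(\mathbf{x}^{(j)},\boldsymbol\xi,\omega)-\alpha^{(j)}_{0\omega}-(\overline{\boldsymbol\alpha}^{(j)}_\omega-\underline{\boldsymbol\alpha}^{(j)}_\omega)^\top\boldsymbol\xi\},$$ with a maximizer $\boldsymbol\xi^*_\omega\in\mathcal{E}_\omega$, and add $\boldsymbol\xi^*_\omega$ to $\mathcal{E}^{(j)}_\omega$. If $n=L$ or $\overline{c}^*_\omega\le\epsilon$, stop; otherwise set $n\leftarrow n+1$ and repeat with the enlarged set. The quantities $\underline{H}_{DR}(\mathbf{x}^{(j)},\omega)$ and $\overline{c}^*_\omega$ retained are those of the last inner iteration performed ($\overline{c}^*_\omega$ being computed with the dual solution of the restricted problem whose value is $\underline{H}_{DR}(\mathbf{x}^{(j)},\omega)$). (iii) Compute $UB^{(j)}$. If $1-LB^{(j)}/UB^{(j)}\le\varepsilon$ stop. Otherwise, for each $\omega$, among the scenarios added in the inner loop, the $M$ with largest values of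 $g(\mathbf{x}^{(j)},\boldsymbol\xi^k_\omega,\omega)p^k$ are kept and added to the master problem's scenario set to form $\mathcal{E}^{(j+1)}_\omega$; set $j\leftarrow j+1$ and return to (i). *)

(* Defs.v *)
From mathcomp Require Import all_boot all_order all_algebra finmap.
From mathcomp Require Import all_classical all_reals all_analysis.

Set Implicit Arguments.
Unset Strict Implicit.
Unset Printing Implicit Defensive.

Import Order.TTheory GRing.Theory Num.Theory.
Import numFieldNormedType.Exports.

Local Open Scope classical_set_scope.
Local Open Scope ring_scope.

Definition dotv (R : realType) n (u v : 'cV[R]_n) : R := (u^T *m v) 0 0.

Definition lev (R : realType) n (u v : 'cV[R]_n) : Prop :=
  forall i, u i 0 <= v i 0.

Definition polyhedron (R : realType) n (A : set 'cV[R]_n) : Prop :=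
  exists q (C : 'M[R]_(q, n)) (b : 'cV[R]_q), A = [set z | lev (C *m z) b].

Definition extreme_points (R : realType) n (A : set 'cV[R]_n) : set 'cV[R]_n :=
  [set z | A z /\ forall (a b : 'cV[R]_n) (t : R), A a -> A b ->
     0 < t < 1 -> z = t *: a + (1 - t) *: b -> a = b].

(* Dimensions: [d] for the uncertain vector, [m] for the investment vector;
   those of the second stage may depend on the long-term scenario. *)
Record dr_problem (R : realType) (disp : measure_display)
    (S : measurableType disp) (Omega : finType) (m d : nat) := DRProblem {
  xit : S -> 'cV[R]_d;
  cell : Omega -> set S;
  mulo : Omega -> 'cV[R]_d;
  muup : Omega -> 'cV[R]_d;
  rho : Omega -> R;
  feasx : set 'cV[R]_m;
  cinv : 'cV[R]_m;
  nvar : Omega -> nat;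
  nrow : Omega -> nat;
  hvec : forall w, 'cV[R]_(nvar w);
  Wmat : forall w, 'M[R]_(nrow w, nvar w);
  bvec : forall w, 'cV[R]_(nrow w);
  Bmat : forall w, 'M[R]_(nrow w, d);
  Tmat : forall w, 'M[R]_(nrow w, m)
}.

Section Model.
Context {R : realType} {disp : measure_display} {S : measurableType disp}.
Context {Omega : finType} {m d : nat} (pb : dr_problem R S Omega m d).

Definition support (w : Omega) : set 'cV[R]_d := xit pb @` cell pb w.

Definition midpoint (w : Omega) : 'cV[R]_d :=
  2^-1 *: (mulo pb w + muup pb w).

Definition recourse_feasible (w : Omega) (x : 'cV[R]_m) (z : 'cV[R]_d)
    (y : 'cV[R]_(nvar pb w)) : Prop :=
  lev 0 y /\
  lev (bvec pb w + Bmat pb w *m z - Tmat pb w *m x) (Wmat pb w *m y).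

Definition recourse_values (x : 'cV[R]_m) (z : 'cV[R]_d) (w : Omega) : set R :=
  [set dotv (hvec pb w) y | y in recourse_feasible x z].

Definition g (x : 'cV[R]_m) (z : 'cV[R]_d) (w : Omega) : R :=
  inf (recourse_values x z w).

(* [has_inf] says that the second-stage linear program is feasible and that
   its objective is bounded below. *)
Record assumptions : Prop := Assumptions {
  xit_borel : forall B : set 'cV[R]_d,
    <<s [set U : set 'cV[R]_d | open U] >> B -> measurable (xit pb @^-1` B);
  cell_measurable : forall w, measurable (cell pb w);
  cell_disjoint : trivIset setT (cell pb);
  cell_cover : \bigcup_w cell pb w = setT;
  support_polyhedron : forall w, polyhedron (support w);
  support_bounded : forall w, bounded_set (support w);
  mu_le : forall w, lev (mulo pb w) (muup pb w);
  midpoint_support : forall w, support w (midpoint w);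
  rho_01 : forall w, 0 <= rho pb w <= 1;
  feasx_binary : forall x, feasx pb x -> forall i, x i 0 = 0 \/ x i 0 = 1;
  recourse_finite : forall x, feasx pb x -> forall w z, support w z ->
    has_inf (recourse_values x z w)
}.

(* A probability measure on [cell pb w], with the restricted sigma-algebra, is
   represented by its extension by zero to [S]. *)
Definition ambiguity (w : Omega) : set (probability S R) :=
  [set P | P (cell pb w) = 1%E /\
    forall i, ((mulo pb w i 0)%:E <= \int[P]_(s in cell pb w) (xit pb s i 0)%:E
               <= (muup pb w i 0)%:E)%E].

Definition H_DR (x : 'cV[R]_m) (w : Omega) : \bar R :=
  ereal_sup [set \int[P]_(s in cell pb w) (g x (xit pb s) w)%:E
            | P in ambiguity w]%E.

Definition dr_cost (x : 'cV[R]_m) : \bar R :=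
  ((dotv (cinv pb) x)%:E + \sum_(w : Omega) (rho pb w)%:E * H_DR x w)%E.

Definition z_DR : \bar R := ereal_inf [set dr_cost x | x in feasx pb].

End Model.

(* The inner iteration limit [maxinner] is [None] when it is infinite. *)
Record eccg_params (R : realType) := EccgParams {
  inner_tol : R;
  maxinner : option nat;
  nkept : nat;
  main_tol : R
}.

Definition valid_params (R : realType) (prm : eccg_params R) : Prop :=
  0 <= inner_tol prm /\
  forall l, maxinner prm = Some l -> (1 <= l)%N /\ (nkept prm <= l)%N.

(* What one inner iteration computes: an optimal solution [prob] of the
   restricted recourse problem, an optimal dual solution, and a maximizer
   [zstar] for the oracle. *)
Record inner_result (R : realType) (d : nat) := InnerResult {
  prob : 'cV[R]_d -> R;
  alpha0 : R;
  alphalo : 'cV[R]_d;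
  alphaup : 'cV[R]_d;
  zstar : 'cV[R]_d
}.

Record master_solution (R : realType) (disp : measure_display)
    (S : measurableType disp) (Omega : finType) (m d : nat)
    (pb : dr_problem R S Omega m d) := MasterSolution {
  xsol : 'cV[R]_m;
  ysol : forall w, 'cV[R]_d -> 'cV[R]_(nvar pb w);
  a0sol : Omega -> R;
  aupsol : Omega -> 'cV[R]_d;
  alosol : Omega -> 'cV[R]_d
}.

(* [last_set w] is the scenario set of the last restricted recourse problem
   solved for [w], before the last oracle maximizer is added. *)
Record main_iteration (R : realType) (disp : measure_display)
    (S : measurableType disp) (Omega : finType) (m d : nat)
    (pb : dr_problem R S Omega m d) := MainIteration {
  msol : master_solution pb;
  last_set : Omega -> {fset 'cV[R]_d};
  last_res : Omega -> inner_result R d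
}.

Section Algorithm.
Context {R : realType} {disp : measure_display} {S : measurableType disp}.
Context {Omega : finType} {m d : nat} (pb : dr_problem R S Omega m d).
Context (prm : eccg_params R).

Definition master_feasible (E : Omega -> {fset 'cV[R]_d})
    (s : master_solution pb) : Prop :=
  feasx pb (xsol s) /\
  forall w, [/\ lev 0 (aupsol s w), lev 0 (alosol s w) &
    forall z, z \in E w ->
      recourse_feasible (xsol s) z (ysol s w z) /\
      dotv (hvec pb w) (ysol s w z)
        <= a0sol s w + dotv (aupsol s w - alosol s w) z].

Definition master_objective (s : master_solution pb) : R :=
  dotv (cinv pb) (xsol s) +
  \sum_(w : Omega) rho pb w *
    (a0sol s w + dotv (muup pb w) (aupsol s w) - dotv (mulo pb w) (alosol s w)).

Definition master_optimal (E : Omega -> {fset 'cV[R]_d})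
    (s : master_solution pb) : Prop :=
  master_feasible E s /\
  forall s', master_feasible E s' -> master_objective s <= master_objective s'.

(* The weights are indexed by the scenarios themselves and vanish outside the
   current scenario set. *)
Definition restricted_feasible (w : Omega) (F : {fset 'cV[R]_d})
    (p : 'cV[R]_d -> R) : Prop :=
  [/\ forall z, 0 <= p z,
      forall z, z \notin F -> p z = 0,
      \sum_(z <- F) p z = 1,
      lev (mulo pb w) (\sum_(z <- F) p z *: z) &
      lev (\sum_(z <- F) p z *: z) (muup pb w)].

Definition restricted_objective (x : 'cV[R]_m) (w : Omega)
    (F : {fset 'cV[R]_d}) (p : 'cV[R]_d -> R) : R :=
  \sum_(z <- F) g pb x z w * p z.

Definition restricted_optimal (x : 'cV[R]_m) (w : Omega)
    (F : {fset 'cV[R]_d}) (p : 'cV[R]_d -> R) : Prop :=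
  restricted_feasible w F p /\
  forall p', restricted_feasible w F p' ->
    restricted_objective x w F p' <= restricted_objective x w F p.

Definition dual_feasible (x : 'cV[R]_m) (w : Omega) (F : {fset 'cV[R]_d})
    (a0 : R) (alo aup : 'cV[R]_d) : Prop :=
  [/\ lev 0 alo, lev 0 aup &
      forall z, z \in F -> g pb x z w <= a0 + dotv (aup - alo) z].

Definition dual_objective (w : Omega) (a0 : R) (alo aup : 'cV[R]_d) : R :=
  a0 + dotv (muup pb w) aup - dotv (mulo pb w) alo.

Definition dual_optimal (x : 'cV[R]_m) (w : Omega) (F : {fset 'cV[R]_d})
    (a0 : R) (alo aup : 'cV[R]_d) : Prop :=
  dual_feasible x w F a0 alo aup /\
  forall a0' alo' aup', dual_feasible x w F a0' alo' aup' ->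
    dual_objective w a0 alo aup <= dual_objective w a0' alo' aup'.

Definition reduced_cost (x : 'cV[R]_m) (w : Omega) (r : inner_result R d)
    (z : 'cV[R]_d) : R :=
  g pb x z w - alpha0 r - dotv (alphaup r - alphalo r) z.

Definition oracle_optimal (x : 'cV[R]_m) (w : Omega) (r : inner_result R d)
    (z : 'cV[R]_d) : Prop :=
  extreme_points (support pb w) z /\
  forall z', support pb w z' -> reduced_cost x w r z' <= reduced_cost x w r z.

Definition inner_iteration (x : 'cV[R]_m) (w : Omega) (F : {fset 'cV[R]_d})
    (r : inner_result R d) : Prop :=
  [/\ restricted_optimal x w F (prob r),
      dual_optimal x w F (alpha0 r) (alphalo r) (alphaup r) &
      oracle_optimal x w r (zstar r)].

Definition H_low (x : 'cV[R]_m) (w : Omega) (F : {fset 'cV[R]_d})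
    (r : inner_result R d) : R :=
  restricted_objective x w F (prob r).

Definition cbar (x : 'cV[R]_m) (w : Omega) (r : inner_result R d) : R :=
  reduced_cost x w r (zstar r).

Definition inner_stop (x : 'cV[R]_m) (w : Omega) (n : nat)
    (r : inner_result R d) : Prop :=
  maxinner prm = Some n \/ cbar x w r <= inner_tol prm.

(* [inner_reach x w E n F]: some execution of the inner loop for [w] begun with
   scenario set [E] performs an [n]-th iteration, with scenario set [F]. *)
Inductive inner_reach (x : 'cV[R]_m) (w : Omega) (E : {fset 'cV[R]_d}) :
    nat -> {fset 'cV[R]_d} -> Prop :=
| InnerStart : inner_reach x w E 1 E
| InnerNext n F r : inner_reach x w E n F -> inner_iteration x w F r ->
    ~ inner_stop x w n r -> inner_reach x w E n.+1 (zstar r |` F)%fset.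

Definition inner_loop (x : 'cV[R]_m) (w : Omega) (E F : {fset 'cV[R]_d})
    (r : inner_result R d) : Prop :=
  exists n, [/\ inner_reach x w E n F, inner_iteration x w F r &
                inner_stop x w n r].

Definition trial (it : main_iteration pb) : 'cV[R]_m := xsol (msol it).

Definition LB (it : main_iteration pb) : R := master_objective (msol it).

Definition H_up (it : main_iteration pb) (w : Omega) : R :=
  H_low (trial it) w (last_set it w) (last_res it w) +
  cbar (trial it) w (last_res it w).

Definition UB (it : main_iteration pb) : R :=
  dotv (cinv pb) (trial it) + \sum_(w : Omega) rho pb w * H_up it w.

Definition eccg_iteration (E : Omega -> {fset 'cV[R]_d})
    (it : main_iteration pb) : Prop :=
  master_optimal E (msol it) /\
  forall w, inner_loop (trial it) w (E w) (last_set it w) (last_res it w).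

Definition added (E : Omega -> {fset 'cV[R]_d}) (it : main_iteration pb)
    (w : Omega) : {fset 'cV[R]_d} :=
  ((zstar (last_res it w) |` last_set it w) `\` E w)%fset.

(* A last oracle maximizer that is new has weight zero: it is not a column of
   the last restricted recourse problem. *)
Definition contribution (it : main_iteration pb) (w : Omega)
    (z : 'cV[R]_d) : R :=
  g pb (trial it) z w * prob (last_res it w) z.

(* If fewer than [nkept prm] scenarios have been added, all of them are kept;
   ties are broken arbitrarily. *)
Definition master_update (E : Omega -> {fset 'cV[R]_d})
    (it : main_iteration pb) (E' : Omega -> {fset 'cV[R]_d}) : Prop :=
  forall w, exists K : {fset 'cV[R]_d},
    [/\ (K `<=` added E it w)%fset,
        #|` K|%fset = minn (nkept prm) #|` added E it w|%fset,
        forall z z', z \in K -> z' \in (added E it w `\` K)%fset ->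
          contribution it w z' <= contribution it w z &
        E' w = (E w `|` K)%fset].

(* [eccg_reach j E]: some execution of the algorithm performs main iteration
   [j], starting with the scenario sets [E]. *)
Inductive eccg_reach : nat -> (Omega -> {fset 'cV[R]_d}) -> Prop :=
| EccgInit : eccg_reach 0 (fun w => [fset midpoint pb w]%fset)
| EccgNext j E it E' : eccg_reach j E -> eccg_iteration E it ->
    ~ (1 - LB it / UB it <= main_tol prm) -> master_update E it E' ->
    eccg_reach j.+1 E'.

End Algorithm.

(* Main.v *)
Require Import Defs.
From mathcomp Require Import all_boot all_order all_algebra finmap.
From mathcomp Require Import all_classical all_reals all_analysis.
From mathcomp Require Import measurable_realfun.
From mathcomp Require Import lra ring.

(** Fix the trial solution [x] and a long-term scenario [w]. The recourse value
    lies between two numbers that the last inner iteration computes: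

      [H_low <= H_DR <= H_low + cbar].

    On the left, an optimal solution of the restricted problem is a finite
    family of weights on points of the support. Each of these points is a value
    of [xit] on the cell, so the weights are carried by a finitely supported
    measure on the cell, which satisfies the moment constraints and belongs to
    the ambiguity set ([restricted_objective_le_H_DR]). On the right, the
    optimal dual solution defines an affine function of the uncertain vector;
    by definition of the oracle, raising it by [cbar] makes it an upper bound
    of [g] on the whole support. Its expectation under a measure of the
    ambiguity set is bounded by means of the moment constraints by the dual
    value plus [cbar] ([H_DR_le_H_low_cbar]), and the dual value does not
    exceed [H_low] by strong duality of linear programming
    ([dual_value_attained], which rests on Farkas' lemma).

    Multiplying by [rho w >= 0] and summing over [w], the right inequality says
    that [UB] is at least the cost of [x], hence at least the optimal value.
    With no limit on the number of inner iterations, the inner loop ends with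
    [cbar <= inner_tol]; then the left inequality and [rho w <= 1] bound [UB]
    by the cost of [x] plus [inner_tol] for each long-term scenario, and both
    inequalities together give equality when [inner_tol] is zero.

    The integral is monotone on arbitrary functions ([le_integral_pointwise]),
    so the expectations of [g] are estimated by comparison with measurable
    functions of the uncertain vector: from above an affine one, from below one
    that agrees with [g] on a finite set and is -oo elsewhere. *)

Import Order.TTheory GRing.Theory Num.Theory.
Import numFieldNormedType.Exports.
Local Open Scope classical_set_scope.
Local Open Scope ring_scope.

Set Implicit Arguments.
Unset Strict Implicit.
Unset Printing Implicit Defensive.

(** * Linear programming duality *)

Lemma scalar0 (R : pzRingType) (V : lmodType R) (f : V -> R) :
  scalar f -> f 0 = 0.
Proof.
by move=> lf; have := lf (-1) 0 0; rewrite scaler0 addr0 mulN1r addNr.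
Qed.

(** Farkas' lemma by Bartl's induction on the number of functionals. When the functional [a i0]
    cannot be dropped, some [v0] violates the implication without it; then
    [a i0 v0 < 0], and projecting along [v0] onto the kernel of [a i0] gives
    functionals on which the implication holds for [s] alone. *)
Lemma farkas (R : realFieldType) (I : eqType) (s : seq I) (V : lmodType R)
    (a : I -> V -> R) (c : V -> R) :
  uniq s -> (forall i, scalar (a i)) -> scalar c ->
  (forall u, (forall i, i \in s -> 0 <= a i u) -> 0 <= c u) ->
  exists l : I -> R, (forall i, 0 <= l i) /\
    forall u, c u = \sum_(i <- s) l i * a i u.
Proof.
elim: s V a c => [|i0 s IH] V a c.
  move=> _ _ lc h; exists (fun=> 0); split=> // u; rewrite big_nil.
  have c0 v : 0 <= c v by exact: h.
  apply/eqP; rewrite eq_le c0 andbT.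
  have := c0 (- 1 *: u + 0); rewrite lc.
  by rewrite (scalar0 lc) addr0 mulN1r oppr_ge0.
move=> /= /andP[i0s us] la lc h.
have cB (f : V -> R) (lf : scalar f) u t v : f (u - t *: v) = f u - t * f v.
  by rewrite addrC -scaleNr lf mulNr addrC.
have [hs|] := pselect (forall u, (forall i, i \in s -> 0 <= a i u) -> 0 <= c u).
  have [l [l0 cl]] := IH V a c us la lc hs.
  exists (fun i => if i == i0 then 0 else l i); split => [i|u].
    by case: ifP.
  rewrite big_cons eqxx mul0r add0r cl; apply: eq_big_seq => i si.
  by case: eqP => // ii0; rewrite -ii0 si in i0s.
move=> /existsNP[v0 /not_implyP[av0 /negP]]; rewrite -ltNge => cv0.
have av0_lt0 : a i0 v0 < 0.
  rewrite ltNge; apply: contraTN cv0 => ai0; rewrite -leNgt.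
  by apply: h => i; rewrite inE => /orP[/eqP->//|/av0].
pose q u := a i0 u / a i0 v0.
pose pr u := u - q u *: v0.
have prl (f : V -> R) (lf : scalar f) : scalar (f \o pr).
  move=> k u v /=; rewrite /pr !cB// /q !la lf; field.
  by rewrite lt_eqF.
have apr u : a i0 (pr u) = 0.
  by rewrite /pr cB// /q divfK ?subrr// lt_eqF.
have [u hu|l [l0 cl]] :=
    IH V (fun i => a i \o pr) (c \o pr) us (fun i => prl _ (la i)) (prl _ lc).
  apply: h => i; rewrite inE => /orP[/eqP->|/hu//].
  by rewrite apr.
(* The value of [l i0] is forced by evaluating the identity at [v0]. *)
pose m0 := (c v0 - \sum_(i <- s) l i * a i v0) / a i0 v0.
exists (fun i => if i == i0 then m0 else l i); split => [i|u].
  case: ifP => // _; rewrite /m0 -mulrNN -invrN mulr_ge0//; last first.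
    by rewrite invr_ge0 oppr_ge0 ltW.
  rewrite opprB subr_ge0 (le_trans (ltW cv0))// big_seq sumr_ge0// => k sk.
  by rewrite mulr_ge0// av0.
rewrite big_cons eqxx.
rewrite [X in _ = _ + X](_ : _ = \sum_(i <- s) l i * a i u); last first.
  apply: eq_big_seq => i si.
  by case: eqP => // ii0; rewrite -ii0 si in i0s.
have := cl u; rewrite /= /pr cB//.
under eq_bigr do rewrite cB// mulrBr.
rewrite sumrB; under [X in _ = _ - X]eq_bigr do rewrite mulrCA.
rewrite -mulr_sumr => /eqP; rewrite subr_eq => /eqP ->.
rewrite /m0 /q; field.
by rewrite lt_eqF.
Qed.

(** The affine case reduces to the linear one by homogenization: with a
    scaling variable [t >= 0], the inequality [c u0 * t <= c u] holds whenever
    [b i * t <= a i u] for all [i]; for [t > 0] this is optimality of [u0] at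
    [u / t], and for [t = 0] the vector [u] is a recession direction, along
    which [c] cannot decrease from [u0]. The multiplier of [t >= 0] is the
    slack in the last inequality, so that optimality conditions need no
    discussion of active constraints. *)
Lemma lp_strong_duality (R : realFieldType) (I : finType) (V : lmodType R)
    (a : I -> V -> R) (b : I -> R) (c : V -> R) (u0 : V) :
  (forall i, scalar (a i)) -> scalar c ->
  (forall i, b i <= a i u0) ->
  (forall u, (forall i, b i <= a i u) -> c u0 <= c u) ->
  exists l : I -> R, [/\ forall i, 0 <= l i,
    forall u, c u = \sum_i l i * a i u & c u0 <= \sum_i l i * b i].
Proof.
move=> la lc fu0 opt.
pose a' (o : option I) (w : V * R^o) : R :=
  if o is Some i then a i w.1 - b i * w.2 else w.2.
pose c' (w : V * R^o) : R := c w.1 - c u0 * w.2.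
have la' o : scalar (a' o).
  case: o => [i|] k [u t] [v r] //=; rewrite /a' /= la -[k *: t]/(k * t); ring.
have lc' : scalar c'.
  move=> k [u t] [v r]; rewrite /c' /= lc -[k *: t]/(k * t); ring.
have h (w : V * R^o) :
    (forall o, o \in enum {: option I} -> 0 <= a' o w) -> 0 <= c' w.
  case: w => u t hw.
  have t0 : 0 <= t :> R by apply: (hw None); rewrite mem_enum.
  have au i : b i * t <= a i u.
    by have := hw (Some i); rewrite mem_enum /a' /= subr_ge0; exact.
  rewrite /c' /= subr_ge0.
  move: t0; rewrite le_eqVlt => /orP[/eqP t0|t0].
    have := opt (1 *: u0 + u); rewrite lc mul1r -t0 mulr0 lerDl; apply=> i.
    by rewrite la mul1r -[b i]addr0 lerD// (le_trans _ (au i))// -t0 mulr0.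
  have ht (f : V -> R) : scalar f -> f (t^-1 *: u) = f u / t.
    move=> lf; rewrite -[_ *: _]addr0 lf.
    by rewrite (scalar0 lf) addr0 mulrC.
  have := opt (t^-1 *: u); rewrite ht// -ler_pdivlMr//; apply=> i.
  by rewrite ht// ler_pdivlMr.
(* [None] indexes the constraint [0 <= t]. *)
have [l [l0 cl]] := @farkas R _ _ _ a' c' (enum_uniq _) la' lc' h.
have cE w : c' w = l None * w.2 + \sum_i l (Some i) * a' (Some i) w.
  rewrite cl big_enum/=.
  rewrite (bigD1 None)//=; congr (_ + _).
  rewrite (reindex_omap Some id)/=; last by case.
  by apply: eq_bigl => i; rewrite eqxx.
exists (l \o Some); split => [i|u|] //=.
  have := cE (u, 0); rewrite /c' /= !mulr0 subr0 add0r => ->.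
  by apply: eq_bigr => i _; rewrite mulr0 subr0.
have := cE (0, 1); rewrite /c' /= scalar0// !mulr1 sub0r.
under eq_bigr do rewrite scalar0// mulr1 sub0r mulrN.
rewrite sumrN => /eqP; rewrite -subr_eq0 => /eqP e.
rewrite -subr_ge0; suff -> : \sum_i l (Some i) * b i - c u0 = l None by [].
by apply/eqP; rewrite -subr_eq0; apply/eqP; rewrite -[RHS]e; ring.
Qed.

(** * The restricted recourse problem and its dual *)

Lemma dotvE (R : realType) n (u v : 'cV[R]_n) :
  dotv u v = \sum_i u i 0 * v i 0.
Proof. by rewrite /dotv mxE; apply: eq_bigr => i _; rewrite mxE. Qed.

Lemma dotv_scalarl (R : realType) n (v : 'cV[R]_n) : scalar (fun u => dotv u v).
Proof.
by move=> k u w; rewrite /dotv linearP /= mulmxDl -scalemxAl !mxE.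
Qed.

Lemma dotv_scalarr (R : realType) n (u : 'cV[R]_n) : scalar (dotv u).
Proof.
by move=> k v w; rewrite /dotv mulmxDr -scalemxAr !mxE.
Qed.

Lemma dotvBl (R : realType) n (u v w : 'cV[R]_n) :
  dotv (u - v) w = dotv u w - dotv v w.
Proof. by rewrite /dotv linearB /= mulmxBl !mxE. Qed.

Lemma dotv_delta (R : realType) n (u : 'cV[R]_n) i :
  dotv u (delta_mx i 0) = u i 0.
Proof.
rewrite dotvE (bigD1 i)//= mxE !eqxx mulr1 big1 ?addr0// => k ki.
by rewrite mxE (negbTE ki) mulr0.
Qed.

Lemma dotvC (R : realType) n (u v : 'cV[R]_n) : dotv u v = dotv v u.
Proof. by rewrite !dotvE; apply: eq_bigr => i _; rewrite mulrC. Qed.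

Lemma dotv_le (R : realType) n (u a b : 'cV[R]_n) :
  lev 0 u -> lev a b -> dotv a u <= dotv b u.
Proof.
move=> u0 ab; rewrite !dotvE; apply: ler_sum => i _.
by rewrite ler_wpM2r//; have := u0 i; rewrite mxE.
Qed.

(** Strong duality for the restricted recourse problem. The dual program
    minimizes over [u = (a0, alo, aup)]; the multipliers of its scenario
    constraints are the weights [p], the coefficient of [a0] makes them sum
    to one, and the multipliers of the sign constraints on [alo] and [aup] are
    the slacks of the two moment constraints. *)
Lemma dual_value_attained (R : realType) (disp : measure_display)
    (S : measurableType disp) (Omega : finType) (m d : nat)
    (pb : dr_problem R S Omega m d) x w (F : {fset 'cV[R]_d}) a0 alo aup :
  dual_optimal pb x w F a0 alo aup ->
  exists p, restricted_feasible pb w F p /\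
    dual_objective pb w a0 alo aup <= restricted_objective pb x w F p.
Proof.
move=> [[alo0 aup0 gle] opt].
pose V : lmodType R := (R^o * 'cV[R]_d * 'cV[R]_d)%type.
pose a (k : F + ('I_d + 'I_d)) (u : V) : R :=
  match k with
  | inl z => u.1.1 + dotv (u.2 - u.1.2) (val z)
  | inr (inl i) => u.1.2 i 0
  | inr (inr i) => u.2 i 0
  end.
pose b (k : F + ('I_d + 'I_d)) : R :=
  if k is inl z then g pb x (val z) w else 0.
pose c (u : V) : R := dual_objective pb w u.1.1 u.1.2 u.2.
have la k : scalar (a k).
  move=> t [[u v] r] [[u' v'] r']; case: k => [z|[i|i]] /=; last first.
  - by rewrite !mxE.
  - by rewrite !mxE.
  rewrite !dotvBl /= !dotv_scalarl -[t *: u]/(t * u); ring.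
have lc : scalar c.
  move=> t [[u v] r] [[u' v'] r']; rewrite /c /dual_objective /=.
  rewrite !dotv_scalarr -[t *: u]/(t * u); ring.
have feasE u : (forall k, b k <= a k u) <->
    dual_feasible pb x w F u.1.1 u.1.2 u.2.
  split=> [h|[h1 h2 h3] [z|[i|i]]] /=.
  - split=> [i|i|z zF].
    + by rewrite mxE; exact: (h (inr (inl i))).
    + by rewrite mxE; exact: (h (inr (inr i))).
    + exact: (h (inl [` zF]%fset)).
  - exact: h3.
  - by have := h1 i; rewrite mxE.
  - by have := h2 i; rewrite mxE.
have [l [l0 cl objl]] : exists l, [/\ forall k, 0 <= l k,
    forall u, c u = \sum_k l k * a k u & c (a0, alo, aup) <= \sum_k l k * b k].
  apply: lp_strong_duality => //; first exact/feasE.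
  by move=> u /feasE; exact: opt.
pose p z := if insub z is Some k then l (inl k) else 0.
have pE (f : 'cV[R]_d -> R) :
    \sum_(z <- F) p z * f z = \sum_(z : F) l (inl z) * f (val z).
  rewrite big_seq_fsetE/=; apply: eq_bigr => z _.
  by rewrite /p valK.
have sumE (f : F + ('I_d + 'I_d) -> R) : \sum_k f k =
    \sum_z f (inl z) + (\sum_i f (inr (inl i)) + \sum_i f (inr (inr i))).
  by rewrite big_sumType/= big_sumType.
have sum_deltaE (f : 'I_d -> R) i :
    \sum_k f k * (delta_mx i 0 : 'cV[R]_d) k 0 = f i.
  have := dotv_delta (\col_k f k) i; rewrite dotvE mxE => <-.
  by apply: eq_bigr => k _; rewrite !mxE.
have pz i : (\sum_(z <- F) p z *: z) i 0 =
    \sum_(z : F) l (inl z) * dotv (delta_mx i 0) (val z).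
  rewrite summxE -(pE (fun z => dotv (delta_mx i 0) z)); apply: eq_bigr => z _.
  by rewrite mxE dotvC dotv_delta.
exists p; split; last first.
  apply: le_trans objl _; rewrite /restricted_objective sumE /b/=.
  rewrite [X in _ + (X + _)]big1 => [|i _]; last by rewrite mulr0.
  rewrite [X in _ + (_ + X)]big1 => [|i _]; last by rewrite mulr0.
  rewrite !addr0.
  have /= := pE (fun z => g pb x z w); under eq_bigr do rewrite mulrC.
  by move=> ->.
split.
- by move=> z; rewrite /p; case: insubP.
- by move=> z zF; rewrite /p insubN.
(* The three remaining constraints come from [cl] at the unit directions. *)
- have := cl ((1 : R^o), 0, 0).
  rewrite /c /dual_objective sumE /= !(scalar0 (@dotv_scalarr _ _ _)).
  rewrite subr0 addr0 => ->.
  rewrite (_ : \sum_(i <- F) p i = \sum_(i <- F) p i * 1); last first.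
    by apply: eq_bigr => z _; rewrite mulr1.
  rewrite (pE (fun=> 1)) [X in _ = _ + (X + _)]big1 => [|i _]; last first.
    by rewrite mxE mulr0.
  rewrite [X in _ = _ + (_ + X)]big1 => [|i _]; last by rewrite mxE mulr0.
  rewrite !addr0.
  apply: eq_bigr => z _.
  by rewrite subr0 (scalar0 (@dotv_scalarl _ _ _)) addr0.
- move=> i; have := cl (0, delta_mx i 0, 0).
  rewrite /c /dual_objective sumE /= (scalar0 (@dotv_scalarr _ _ _)).
  rewrite addr0 add0r.
  rewrite dotv_delta [X in _ = _ + (_ + X)]big1 ?addr0; last first.
    by move=> k _; rewrite mxE mulr0.
  rewrite sum_deltaE pz.
  under eq_bigr do
    rewrite dotvBl (scalar0 (@dotv_scalarl _ _ _)) sub0r add0r mulrN.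
  rewrite sumrN => h; have := l0 (inr (inl i)); lra.
- move=> i; have := cl (0, 0, delta_mx i 0).
  rewrite /c /dual_objective sumE /= (scalar0 (@dotv_scalarr _ _ _)).
  rewrite subr0 add0r.
  rewrite dotv_delta [X in _ = _ + (X + _)]big1 ?add0r; last first.
    by move=> k _; rewrite mxE mulr0.
  rewrite sum_deltaE pz.
  under eq_bigr do rewrite subr0 add0r.
  move=> h; have := l0 (inr (inr i)); lra.
Qed.

(** * Integrals of arbitrary functions and finitely supported measures *)

Section PointwiseMonotonicity.
Import HBNNSimple.

(** The integral of a nonnegative function is a supremum over the simple
    functions below it, so monotonicity holds for all functions, measurable
    or not. It applies to the second-stage cost [g] as a function of the
    uncertain vector. *)
Lemma le_integral_pointwise (R : realType) (disp : measure_display)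
    (T : measurableType disp) (P : {measure set T -> \bar R}) (D : set T)
    (f h : T -> \bar R) :
  (forall s, D s -> (f s <= h s)%E) ->
  (\int[P]_(s in D) f s <= \int[P]_(s in D) h s)%E.
Proof.
move=> fh.
have mono (u v : T -> \bar R) :
    (forall s, 0 <= u s)%E -> (forall s, 0 <= v s)%E ->
    (forall s, D s -> (u s <= v s)%E) ->
    (\int[P]_(s in D) u s <= \int[P]_(s in D) v s)%E.
  move=> u0 v0 uv; rewrite !ge0_integralE//.
  apply: ge_ereal_sup => _ [k /= ku <-]; apply: ereal_sup_ubound.
  exists k => //= s.
  apply: (le_trans (ku s)); rewrite /patch; case: ifPn => // /[!inE]; exact: uv.
rewrite [leLHS]integralE [leRHS]integralE leeB//.
- apply: mono => // s /mem_set Ds; apply: (funepos_le _ Ds) => t /[!inE].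
  exact: fh.
- apply: mono => // s /mem_set Ds; apply: (funeneg_le _ Ds) => t /[!inE].
  exact: fh.
Qed.

End PointwiseMonotonicity.

(** The probability is the sum of the Dirac masses at [s i] with weights
    [p i]. Finiteness of [f] is asked at the points [s i] only, so that the
    equality applies to lower approximations of [g] equal to -oo elsewhere. *)
Lemma finite_support_probability (R : realType) (disp : measure_display)
    (T : measurableType disp) n (p : nat -> R) (s : nat -> T) :
  (forall i, 0 <= p i) -> \sum_(i < n) p i = 1 ->
  exists P : probability T R, forall (D : set T) (f : T -> \bar R),
    measurable D -> measurable_fun D f ->
    (forall i, (i < n)%N -> D (s i) /\ f (s i) \is a fin_num) ->
    (\int[P]_(t in D) f t = (\sum_(i < n) p i * fine (f (s i)))%:E)%E.
Proof.
move=> p0 p1.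
pose mu_ k : {measure set T -> \bar R} := mscale (NngNum (p0 k)) (\d_(s k)).
pose mu : {measure set T -> \bar R} := msum mu_ n.
have muT : mu setT = 1%E.
  rewrite /mu /= /msum /mu_ /= /mscale /=.
  under eq_bigr do rewrite diracT mule1.
  by rewrite sumEFin p1.
(* Normalizing a measure of total mass one does not change it; it only equips
   it with its structure of probability measure. *)
exists (mnormalize mu \d_(s 0%N)) => D f mD mf Ds.
have -> : (\int[mnormalize mu \d_(s 0%N)]_(t in D) f t =
    \int[mu]_(t in D) f t)%E.
  apply: eq_measure_integral => A mA AD /=.
  by rewrite /mnormalize muT onee_eq0 /= invr1 mule1.
have pos (u : T -> \bar R) : measurable_fun D u -> (forall t, 0 <= u t)%E ->
    (\int[mu]_(t in D) u t = \sum_(i < n) (p i)%:E * u (s i))%E.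
  move=> mD' u0; rewrite ge0_integral_measure_sum//; apply: eq_bigr => i _.
  rewrite ge0_integral_mscale// integral_dirac//= diracE mem_set ?mul1e//.
  by have [] := Ds i (ltn_ord i).
rewrite integralE !pos//;
  [|exact: measurable_funeneg|exact: measurable_funepos].
have fE i : (i < n)%N -> f (s i) = (fine (f (s i)))%:E.
  by move=> /Ds[_ /fineK].
under eq_bigr => i _ do rewrite funeposE (fE i (ltn_ord i)) -EFin_max -EFinM.
under [X in (_ - X)%E]eq_bigr => i _ do
  rewrite funenegE (fE i (ltn_ord i)) -EFinN -EFin_max -EFinM.
rewrite !sumEFin -EFinB -sumrB; congr (_%:E); apply: eq_bigr => i _.
rewrite -mulrBr; congr (_ * _).
by case: (leP (fine _) 0) => h; case: (leP (- _) 0) => h'; lra.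
Qed.

(** * Moments under ambiguous measures *)

Section Expectation.
Context {R : realType} {disp : measure_display} {S : measurableType disp}.
Context {Omega : finType} {m d : nat} (pb : dr_problem R S Omega m d).
Hypothesis hpb : assumptions pb.

Lemma measurable_coordinate i : measurable_fun setT (fun s => xit pb s i 0).
Proof.
apply: (measurability _ (RGenOpens.measurableE R)) => _ [_ [a [b ->]] <-].
rewrite setTI.
apply: (xit_borel hpb (B := (fun z : 'cV[R]_d => z i 0) @^-1` `]a, b[%classic)).
apply: sub_sigma_algebra => /=; apply: open_comp; last exact: interval_open.
by move=> z _; exact: coord_continuous.
Qed.

Lemma bounded_coordinate w i : [bounded xit pb s i 0 | s in cell pb w].
Proof.
have [M [Mr MB]] := support_bounded hpb w.
exists M; split => // e Me s ws /=.
apply: le_trans (MB e Me (xit pb s) _) => /=; last by exists s.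
by rewrite [leRHS]mx_normrE; apply: (le_bigmax _ _ (i, 0)).
Qed.

(** The support being bounded, [xit] is integrable and has a mean vector [M];
    all that an ambiguous measure retains of [xit] against affine functions is
    this vector. *)
Lemma ambiguity_moment w (P : probability S R) : ambiguity pb w P ->
  exists M : 'cV[R]_d, [/\ lev (Defs.mulo pb w) M, lev M (muup pb w) &
    forall a0 v, \int[P]_(s in cell pb w) (a0 + dotv v (xit pb s))%:E
                 = (a0 + dotv v M)%:E]%E.
Proof.
move=> [Pw mom].
have mw := cell_measurable hpb w.
have int_xi i : P.-integrable (cell pb w) (EFin \o (fun s => xit pb s i 0)).
  apply: measurable_bounded_integrable => //.
  - have PwE : (P (cell pb w) < +oo)%E by rewrite Pw ltry.
    exact: PwE.
  - by apply: measurable_funTS; exact: measurable_coordinate.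
  - exact: bounded_coordinate.
pose M : 'cV[R]_d :=
  \col_i fine (\int[P]_(s in cell pb w) (xit pb s i 0)%:E)%E.
have ME i : (\int[P]_(s in cell pb w) (xit pb s i 0)%:E = (M i 0)%:E)%E.
  by rewrite mxE fineK//; exact: integrable_fin_num (int_xi i).
exists M; split=> [i|i|a0 v].
- by have /andP[] := mom i; rewrite ME !lee_fin.
- by have /andP[] := mom i; rewrite ME !lee_fin.
under eq_integral do rewrite dotvE EFinD -sumEFin.
rewrite integralD//=; last 2 first.
- exact: finite_measure_integrable_cst.
- apply: (@integrable_sum _ _ _ _ _ mw _ _ _
    (fun i s => (v i 0 * xit pb s i 0)%:E)) => i.
  move=> _; exact: (integrableZl mw (v i 0) (int_xi i)).
rewrite integral_cst// -[X in (a0%:E * X)%E]/(P (cell pb w)) Pw mule1.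
rewrite (@integral_sum _ _ _ _ _ mw _
    (fun i s => (v i 0 * xit pb s i 0)%:E)) => [|i]; last first.
  exact: (integrableZl mw (v i 0) (int_xi i)).
rewrite EFinD dotvE -sumEFin; congr (_ + _)%E; apply: eq_bigr => i _.
by rewrite EFinM -ME -integralZl//; exact: int_xi.
Qed.

End Expectation.

(** * Bounds on the recourse value *)

Section Bounds.
Context {R : realType} {disp : measure_display} {S : measurableType disp}.
Context {Omega : finType} {m d : nat} (pb : dr_problem R S Omega m d).
Hypothesis hpb : assumptions pb.

(** Weak duality with a correction. On the whole support the affine function
    of the dual solution, raised by the largest reduced cost [cbar], lies above
    [g]; its expectation depends on the mean only, and is at most the dual
    value plus [cbar] since [alo] and [aup] are nonnegative. Strong duality
    turns the dual value into [H_low]. *)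
Lemma H_DR_le_H_low_cbar x w F r : inner_iteration pb x w F r ->
  (H_DR pb x w <= (H_low pb x w F r + cbar pb x w r)%:E)%E.
Proof.
move=> [[_ opt] dopt [_ oracle]].
have [p [fp /le_trans/(_ (opt _ fp)) H_low_ge]] := dual_value_attained dopt.
have [[alo0 aup0 _] _] := dopt.
apply: ge_ereal_sup => _ [P PA <-].
have [M [loM Mup EM]] := ambiguity_moment hpb PA.
apply: (@le_trans _ _ (\int[P]_(s in cell pb w)
   (alpha0 r + cbar pb x w r + dotv (alphaup r - alphalo r) (xit pb s))%:E)%E).
  apply: le_integral_pointwise => s ws; rewrite lee_fin.
  have := oracle (xit pb s) (ex_intro2 _ _ s ws erefl).
  rewrite /cbar {1}/reduced_cost; lra.
rewrite EM lee_fin dotvBl.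
move: H_low_ge; rewrite /H_low /dual_objective.
have := dotv_le alo0 loM; have := dotv_le aup0 Mup.
rewrite (dotvC M) (dotvC M); lra.
Qed.

(** Finite sets are closed, so that functions of [xit] with finitely many
    exceptional values are measurable, however irregular these values are. *)
Lemma measurable_on_fset (F : {fset 'cV[R]_d}) (f : 'cV[R]_d -> \bar R) y :
  measurable_fun setT (fun s => if xit pb s \in F then f (xit pb s) else y).
Proof.
have mA (A : set 'cV[R]_d) :
    A `<=` [set` F] -> measurable (xit pb @^-1` (~` A)).
  move=> AF; apply: (xit_borel hpb); apply: sub_sigma_algebra => /=.
  have : accessible_space 'cV[R]_d.
    by apply: hausdorff_accessible; exact: norm_hausdorff.
  rewrite openC => /accessible_finite_set_closed; apply.
  by apply: (sub_finite_set AF); exact: finite_fset.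
move=> _ B mB; rewrite setTI.
have [By|By] := pselect (B y).
  rewrite (_ : _ @^-1` B = xit pb @^-1` (~` [set z | z \in F /\ ~ B (f z)])).
    by apply: mA => z [].
  apply/seteqP; split=> s /=; case: ifP => sF //.
  - by move=> Bs [].
  - by move=> _ [].
  - by move=> h; apply: contrapT => nB; apply: h.
rewrite (_ : _ @^-1` B = ~` (xit pb @^-1` (~` [set z | z \in F /\ B (f z)]))).
  by apply: measurableC; apply: mA => z [].
apply/seteqP; split=> s /=; case: ifP => sF //.
- by move=> Bs; apply.
- by move=> /contrapT[].
- by move=> /contrapT[].
Qed.

(** Scenarios of the support are values of [xit] on the cell, so that weights
    [p] on them lift to a measure of the ambiguity set that gives [g] at least
    the expectation [restricted_objective]. *)
Lemma restricted_objective_le_H_DR x w (F : {fset 'cV[R]_d}) p :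
  (forall z, z \in F -> Defs.support pb w z) -> restricted_feasible pb w F p ->
  ((restricted_objective pb x w F p)%:E <= H_DR pb x w)%E.
Proof.
move=> Fsupp [p0 _ p1 lop pup].
have [s0 _ _] := midpoint_support hpb w.
have [s sP] : exists s : 'cV[R]_d -> S,
    forall z, z \in F -> cell pb w (s z) /\ xit pb (s z) = z.
  have /choice[s sP] : forall z, exists t,
      z \in F -> cell pb w t /\ xit pb t = z.
    move=> z; case: (boolP (z \in F)) => zF; last by exists s0.
    by have [t wt tz] := Fsupp z zF; exists t.
  by exists s.
pose t i := s (nth 0 F i).
have pn1 : \sum_(i < #|`F|%fset) p (nth 0 F i) = 1.
  by rewrite -p1 [RHS](big_nth 0) big_mkord.
have [P EP] := finite_support_probability t (fun i => p0 (nth 0 F i)) pn1.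
have mw := cell_measurable hpb w.
have nthF i : (i < #|`F|%fset)%N -> nth 0 F i \in F by move=> ?; exact: mem_nth.
have E (f : S -> \bar R) (h : 'cV[R]_d -> R) : measurable_fun (cell pb w) f ->
    (forall z, z \in F -> f (s z) = (h z)%:E) ->
    (\int[P]_(u in cell pb w) f u = (\sum_(z <- F) p z * h z)%:E)%E.
  move=> mf fh; rewrite EP// => [|i iF]; last first.
    by rewrite /t fh ?nthF//; split=> //; apply sP; exact: nthF.
  congr (_%:E); rewrite [RHS](big_nth 0) big_mkord; apply: eq_bigr => i _.
  by rewrite /t fh ?nthF.
apply: (@le_trans _ _ (\int[P]_(u in cell pb w) (g pb x (xit pb u) w)%:E)%E).
  (* Off [F] the integrand is lowered to -oo, which makes it measurable and,
     the preimage of [F] having full measure, costs nothing. *)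
  pose f z : \bar R := (g pb x z w)%:E.
  apply: (@le_trans _ _ (\int[P]_(u in cell pb w)
      (if xit pb u \in F then f (xit pb u) else -oo))%E).
    rewrite (E _ (fun z => g pb x z w)); last 2 first.
    - by apply: measurable_funTS; exact: measurable_on_fset.
    - by move=> z zF; have [_ ->] := sP z zF; rewrite zF.
    rewrite lee_fin /restricted_objective le_eqVlt; apply/orP; left.
    by apply/eqP; apply: eq_bigr => z _; rewrite mulrC.
  by apply: le_integral_pointwise => u _; case: ifP => // _; rewrite leNye.
apply: ereal_sup_ubound; exists P => //; split.
  rewrite -[LHS]mul1e -integral_cst//.
  rewrite (E _ (fun=> 1))//.
  by under eq_bigr do rewrite mulr1; rewrite p1.
move=> i; rewrite (E _ (fun z => z i 0)); last 2 first.
- apply/measurable_EFinP; apply: measurable_funTS; exact: measurable_coordinate.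
- by move=> z zF; have [_ ->] := sP z zF.
have -> : \sum_(z <- F) p z * z i 0 = (\sum_(z <- F) p z *: z) i 0.
  by rewrite summxE; apply: eq_bigr => z _; rewrite mxE.
by rewrite !lee_fin lop pup.
Qed.

(** * Scenario sets along the algorithm *)

Section Run.
Variable prm : eccg_params R.

Lemma inner_reach_support x w E n F :
  (forall z, z \in E -> Defs.support pb w z) -> inner_reach pb prm x w E n F ->
  forall z, z \in F -> Defs.support pb w z.
Proof.
move=> Esupp; elim=> // {}n {}F r _ IH [_ _ [[zs _] _]] _ z.
by rewrite in_fset1U => /orP[/eqP->|/IH].
Qed.

Lemma last_set_support E (it : main_iteration pb) w : eccg_iteration prm E it ->
  (forall z, z \in E w -> Defs.support pb w z) ->
  forall z, z \in last_set it w -> Defs.support pb w z.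
Proof.
by move=> [_ /(_ w)[n [reach _ _]]] /inner_reach_support; apply; exact: reach.
Qed.

(** The initial scenarios are the midpoints, and all others are maximizers of
    the oracle, which lie in the support. *)
Lemma eccg_reach_support j E : eccg_reach pb prm j E ->
  forall w z, z \in E w -> Defs.support pb w z.
Proof.
elim=> [w z|{}j {}E it E' _ IH hit _ upd w z].
  by rewrite in_fset1 => /eqP->; exact: midpoint_support.
have [K [/fsubsetP KE _ _ ->]] := upd w.
rewrite in_fsetU => /orP[/IH//|/KE].
rewrite in_fsetD in_fset1U => /andP[_ /orP[/eqP->|zl]].
  by have [_ /(_ w)[n [_ [_ _ [[]]]]]] := hit.
exact: (last_set_support hit (IH w) zl).
Qed.

End Run.
End Bounds.

(** * The upper bound *)

Theorem theorem1 (R : realType) (disp : measure_display)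
  (S : measurableType disp) (Omega : finType) (m d : nat)
  (pb : dr_problem R S Omega m d) (prm : eccg_params R)
  (hpb : assumptions pb) (hprm : valid_params prm)
  (j : nat) (E : Omega -> {fset 'cV[R]_d}) (it : main_iteration pb)
  (hE : eccg_reach pb prm j E) (hit : eccg_iteration prm E it) :
  [/\ (z_DR pb <= (UB it)%:E)%E,
      maxinner prm = None ->
        ((UB it)%:E <= (dotv (cinv pb) (trial it))%:E
           + \sum_(w : Omega) (rho pb w)%:E * H_DR pb (trial it) w
           + (#|Omega|%:R * inner_tol prm)%:E)%E &
      maxinner prm = None -> inner_tol prm = 0 ->
        (UB it)%:E = ((dotv (cinv pb) (trial it))%:E
           + \sum_(w : Omega) (rho pb w)%:E * H_DR pb (trial it) w)%E].
Proof.
pose low w := H_low pb (trial it) w (last_set it w) (last_res it w).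
pose gap w := cbar pb (trial it) w (last_res it w).
have rho0 w : 0 <= rho pb w by have /andP[] := rho_01 hpb w.
have loop w := hit.2 w.
have low_le w : ((low w)%:E <= H_DR pb (trial it) w)%E.
  have [n [_ [[feas _] _ _] _]] := loop w.
  apply: restricted_objective_le_H_DR => //.
  by apply: (last_set_support hit); exact: (eccg_reach_support hpb hE).
have le_up w : (H_DR pb (trial it) w <= (low w + gap w)%:E)%E.
  by have [n [_ inner _]] := loop w; exact: H_DR_le_H_low_cbar inner.
(* Being squeezed between real numbers, the recourse values are real, and the
   costs can be compared in [R]. *)
have [H HE] : exists H, forall w, H_DR pb (trial it) w = (H w)%:E.
  exists (fun w => fine (H_DR pb (trial it) w)) => w; rewrite fineK//.
  rewrite fin_numElt (lt_le_trans (ltNyr _) (low_le w)).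
  exact: le_lt_trans (le_up w) (ltry _).
have costE : ((dotv (cinv pb) (trial it))%:E
    + \sum_(w : Omega) (rho pb w)%:E * H_DR pb (trial it) w)%E
    = (dotv (cinv pb) (trial it) + \sum_(w : Omega) rho pb w * H w)%:E.
  rewrite EFinD -sumEFin; congr (_ + _)%E; apply: eq_bigr => w _.
  by rewrite HE EFinM.
have UB_ge : dotv (cinv pb) (trial it) + \sum_w rho pb w * H w <= UB it.
  rewrite lerD2l; apply: ler_sum => w _; rewrite ler_wpM2l//.
  by rewrite -lee_fin -HE le_up.
have tight : maxinner prm = None -> UB it <= dotv (cinv pb) (trial it)
    + \sum_w rho pb w * H w + #|Omega|%:R * inner_tol prm.
  move=> Linf; rewrite -addrA lerD2l.
  rewrite -sum1_card natr_sum mulr_suml -big_split/=; apply: ler_sum => w _.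
  have [n [_ _ [|gap_le]]] := loop w; first by rewrite Linf.
  have {}low_le : low w <= H w by rewrite -lee_fin -HE.
  rewrite mulrDr lerD ?ler_wpM2l// (le_trans (ler_wpM2l (rho0 w) gap_le))//.
  by rewrite ler_wpM2r//; [exact: hprm.1|have /andP[] := rho_01 hpb w].
split=> [|Linf|Linf eps0]; rewrite ?costE.
- apply: (@le_trans _ _ (dr_cost pb (trial it))).
    by apply: ereal_inf_lbound; exists (trial it) => //; exact: hit.1.1.1.
  by rewrite /dr_cost costE lee_fin.
- by rewrite -EFinD lee_fin tight.
- congr (_%:E); apply/eqP; rewrite eq_le UB_ge andbT.
  by have := tight Linf; rewrite eps0 mulr0 addr0.
Qed.
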